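(* Let $C$ be an ideal of $\mathcal{R}_2=\frac{GR(p^2,m)[x]}{\langle f(x)\rangle}$. Then $C$ can be expressed in one of the following forms: (1) $\langle 0\rangle$, (2) $\langle 1\rangle$, (3) $\langle ph(x)^n\rangle$, (4) $\langle h(x)^k\rangle$, (5) $\langle h(x)^k+ph(x)^\ell\delta(x)\rangle$, (6) $\langle h(x)^k,\ ph(x)^n\rangle$, (7) $\langle h(x)^k+ph(x)^\ell\delta(x),\ ph(x)^n\rangle$, where in any case the nonnegative integers $k,\ell,n$ that occur satisfy $k,\ell,n<t$ and $\ell<n<k$ (for those of these inequalities whose members occur; in form (5), $\ell<k$), and $\delta(x)=\sum_{j=0}^{k-1-\ell}\eta_j(x)h(x)^j$ with $\eta_j(x)\in\mathcal{T}_m[x]$, $\eta_0(x)\ne 0$ and $\deg\eta_j(x)<\deg h(x)$.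
   Context: $p$ is a prime, $m\ge 1$; $GR(p^2,m)$ is the Galois ring of characteristic $p^2$ with $p^{2m}$ elements, with maximal ideal $\langle p\rangle$ and residue field $\mathbb{F}_{p^m}$. $\mathcal{T}_m=\{0,1,\zeta,\dots,\zeta^{p^m-2}\}\subset GR(p^2,m)$ is the Teichmüller set ($\zeta$ of multiplicative order $p^m-1$), and $\mathcal{T}_m[x]$ is the set of polynomials with coefficients in $\mathcal{T}_m$. Standing assumption: $f(x)\in GR(p^2,m)[x]$ is a monic regular (not a zero divisor) primary (generating a primary ideal) polynomial, not a unit, of the form $f(x)=h(x)^t+p\beta(x)$ with $t\ge1$, $h(x)$ monic basic irreducible (irreducible with irreducible reduction modulo $p$), and $\beta(x)\in GR(p^2,m)[x]$ with $\beta(x)=0$ or $\deg\beta(x)<t\deg h(x)$. *)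

(* Defs.v *)
From HB Require Import structures.
From mathcomp Require Import all_boot all_order all_algebra.
From mathcomp Require Import qpoly.
From mathcomp Require Import boolp classical_sets.

Set Implicit Arguments.
Unset Strict Implicit.
Unset Printing Implicit Defensive.

Import GRing.Theory.
Local Open Scope classical_set_scope.
Local Open Scope ring_scope.

Section Ideals.
Variable A : comNzRingType.

(* GRing.unit is not usable here: {poly R} is a unitRingType only when R is an
   integral domain. *)
Definition is_unit (a : A) : Prop := exists b : A, b * a = 1.

Definition irreducible_elt (a : A) : Prop :=
  [/\ a <> 0, ~ is_unit a &
      forall b c : A, a = b * c -> is_unit b \/ is_unit c].

(* Unlike idealr of ring_quotient, this allows the improper ideal setT and does
   not ask for decidable membership. *)
Definition is_ideal (I : set A) : Prop :=
  [/\ I 0, (forall x y, I x -> I y -> I (x + y)) &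
      forall a x, I x -> I (a * x)].

Definition primary_ideal (I : set A) : Prop :=
  [/\ is_ideal I, ~ I 1 &
      forall a b, I (a * b) -> I a \/ exists n : nat, I (b ^+ n)].

Definition ideal_gen (G : set A) : set A := smallest is_ideal G.

End Ideals.

(* R is GR(p^2, m), and pi : R -> K is the reduction modulo its maximal ideal
   <p>, onto its residue field K of order p^m. *)
Record is_galois_ring (p m : nat) (R : finComNzRingType) (K : finFieldType)
    (pi : {rmorphism R -> K}) : Prop := IsGaloisRing {
  galois_ring_char : forall n : nat, (n%:R = 0 :> R) <-> (p ^ 2 %| n)%N;
  galois_ring_card : #|R| = (p ^ (2 * m))%N;
  galois_ring_residue_surj : forall y : K, exists x : R, pi x = y;
  galois_ring_residue_ker :
    forall x : R, (pi x = 0) <-> ideal_gen [set p%:R] x;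
  (* makes <p> the only maximal ideal *)
  galois_ring_local : forall x : R, pi x <> 0 -> is_unit x;
  galois_ring_residue_card : #|K| = (p ^ m)%N
}.

Section Polynomials.
Variable R : finComNzRingType.

Definition teichmuller (p m : nat) (zeta : R) : {pred R} :=
  [pred a | (a == 0) || [exists i : 'I_(p ^ m - 1), a == zeta ^+ i]].

Definition basic_irreducible (K : finFieldType) (pi : {rmorphism R -> K})
    (h : {poly R}) : Prop :=
  irreducible_elt h /\ irreducible_poly (map_poly pi h).

(* delta = \sum_(0 <= j <= k-1-l) eta_j h^j; used for l < k only.  Since
   size 0 = 0 and h is monic, size (eta_j) < size h is deg eta_j < deg h
   (with deg 0 = -oo). *)
Definition is_delta (T : {pred R}) (h : {poly R}) (k l : nat)
    (delta : {poly R}) : Prop :=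
  exists eta : nat -> {poly R},
    [/\ eta 0%N <> 0,
        forall j, (j < k - l)%N ->
          eta j \is a polyOver T /\ (size (eta j) < size h)%N &
        delta = \sum_(j < k - l) eta j * h ^+ j].

End Polynomials.

(* Main.v *)
Require Import Defs.
From HB Require Import structures.
From mathcomp Require Import all_boot all_order all_algebra.
From mathcomp Require Import qpoly.
From mathcomp Require Import boolp classical_sets.
From mathcomp Require Import ring.

Set Implicit Arguments.
Unset Strict Implicit.
Unset Printing Implicit Defensive.

Import GRing.Theory.
Local Open Scope classical_set_scope.
Local Open Scope ring_scope.

(** The quotient by [f] is studied upstairs: [C] is replaced by its preimage [I]
    in [{poly R}], an ideal containing [f], and the whole structure of [I] is
    read off two ideals of the principal ideal domain [{poly K}]: the reduction
    of [I] modulo [p], and the torsion ideal of the reductions of those [g] with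
    [p * g] in [I].  Both contain the [t]-th power of the irreducible reduction
    of [h], because [f] reduces to that power, so they are generated by powers
    of it, with exponents [k] and [n] at most [t]
    ([ideal_irreducible_power]).  Since [p * I] lies in [I], [n <= k].

    Lifting a generator of the reduction gives [h ^+ k + p * g] in [I].
    Subtracting a multiple of it from an element of [I] leaves an element
    [p * y] of [I]; then [y] reduces into the torsion ideal, and as [p * p = 0]
    only the reduction of [y] counts, so [p * y] is a multiple of [p * h ^+ n].
    Hence
    [I] is generated by [h ^+ k + p * g] and [p * h ^+ n], for every admissible
    [g] ([ideal_two_generators]).

    The freedom in [g] is used twice.  When [k = t] one takes [g = beta]: the
    first generator is [f], which dies in the quotient, and [C] is generated by
    [p * h ^+ n], which is zero if [n = t].  When [0 < k < t], [g] only matters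
    modulo [p] and [h ^+ n], so it can be replaced by a truncated [h]-adic
    expansion with Teichmuller digits ([adic_expansion]); either all digits
    vanish and the first generator is [h ^+ k], or factoring out the lowest
    nonzero digit gives [delta] ([delta_factor]).  If [n = k] the second
    generator is redundant, because [p * (h ^+ k + p * g) = p * h ^+ k].  When
    [k = 0] the first generator is [1 + p * g], a unit with inverse
    [1 - p * g]. *)

(** * Ideals of commutative rings *)

Lemma eq_ideal_gen (A : comNzRingType) (C G : set A) :
    is_ideal C -> G `<=` C ->
    (forall J : set A, is_ideal J -> G `<=` J -> C `<=` J) ->
  C = ideal_gen G.
Proof.
move=> C_ideal G_sub C_min; rewrite eqEsubset; split; last exact: smallest_sub.
by move=> x Cx J [J_ideal G_subJ]; apply: (C_min J).
Qed.

Lemma ideal_gen1_eq (A : comNzRingType) (C : set A) (a : A) :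
    is_ideal C -> C a -> (forall x, C x -> exists u, x = u * a) ->
  C = ideal_gen [set a].
Proof.
move=> C_ideal Ca gen; apply: eq_ideal_gen => [//|_ -> //|J [_ _ JM] GJ x Cx].
by have [u ->] := gen x Cx; apply/JM/GJ.
Qed.

Lemma ideal_gen2_eq (A : comNzRingType) (C : set A) (a b : A) :
    is_ideal C -> C a -> C b ->
    (forall x, C x -> exists u v, x = u * a + v * b) ->
  C = ideal_gen [set a; b].
Proof.
move=> C_ideal Ca Cb gen.
apply: eq_ideal_gen => [//|_ [-> | ->] //|J [_ JD JM] GJ x Cx].
by have [u [v ->]] := gen x Cx; apply: JD; apply/JM/GJ; [left | right].
Qed.

Lemma ideal_gen1P (A : comNzRingType) (a x : A) :
  ideal_gen [set a] x <-> exists u, x = u * a.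
Proof.
split=> [|[u ->]]; last by move=> J [[_ _ JM] /(_ a erefl)]; apply: JM.
apply: (smallest_sub (X := [set x | exists u, x = u * a])) => [|_ ->]; last first.
  by exists 1; rewrite mul1r.
split=> [|_ _ [u ->] [v ->]|b _ [u ->]]; first by exists 0; rewrite mul0r.
  by exists (u + v); rewrite mulrDl.
by exists (b * u); rewrite mulrA.
Qed.

Lemma ideal_sub (A : comNzRingType) (I : set A) x y :
  is_ideal I -> I x -> I y -> I (x - y).
Proof. by move=> [_ ID IM] Ix Iy; apply: ID => //; rewrite -mulN1r; apply: IM. Qed.

Lemma ideal_preimage (A B : comNzRingType) (q : {rmorphism A -> B}) (C : set B) :
  is_ideal C -> is_ideal (q @^-1` C).
Proof.
move=> [C0 CD CM]; split=> [|x y|a x] /=; rewrite ?rmorph0 ?rmorphD ?rmorphM //.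
  exact: CD.
exact: CM.
Qed.

Lemma ideal_image (A B : comNzRingType) (q : {rmorphism A -> B}) (I : set A) :
  (forall y, exists x, q x = y) -> is_ideal I -> is_ideal (q @` I).
Proof.
move=> q_surj [I0 ID IM]; split.
- by exists 0; rewrite ?rmorph0.
- by move=> _ _ [x Ix <-] [y Iy <-]; exists (x + y); rewrite ?rmorphD //; apply: ID.
move=> b _ [x Ix <-]; have [a <-] := q_surj b.
by exists (a * x); rewrite ?rmorphM //; apply: IM.
Qed.

(** * Two-generator ideals over a square-zero reduction *)

(** If [h ^+ k] is the least power of [h] in [D] and [b] in [D] were exactly
    divisible by [h ^+ j] with [j < k], then the cofactor of [h ^+ j] in [b]
    would be coprime to [h ^+ k], and Bezout would put [h ^+ j] in [D]. *)
Lemma ideal_irreducible_power (F : fieldType) (h : {poly F}) (t : nat)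
    (D : set {poly F}) :
    irreducible_poly h -> is_ideal D -> D (h ^+ t) ->
  exists2 k, (k <= t)%N & forall b, D b <-> h ^+ k %| b.
Proof.
move=> h_irr [D0 DD DM] Dht.
have Dh_ex : exists k, `[< D (h ^+ k) >] by exists t; apply/asboolP.
case: (ex_minnP Dh_ex) => k /asboolP Dhk k_min.
exists k => [|b]; first by apply: k_min; apply/asboolP.
split=> [Db|/dvdpP[c ->]]; last exact: DM.
suff dvd j : (j <= k)%N -> h ^+ j %| b by apply: dvd.
elim: j => [|j IHj] lt_jk; first by rewrite expr0 dvd1p.
have /dvdpP[c b_def] := IHj (ltnW lt_jk).
rewrite b_def exprS dvdp_mul2r ?expf_neq0 ?irredp_neq0 //.
apply: contraLR lt_jk; rewrite -irreducible_poly_coprime // -leqNgt => h_c.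
have /Bezout_eq1_coprimepP[[u v] /= uv1] := coprimep_expl k h_c.
apply: k_min; apply/asboolP.
rewrite -[h ^+ j]mul1r -uv1 mulrDl; apply: DD.
  by rewrite mulrAC; apply: DM.
by rewrite -mulrA -b_def; apply: DM.
Qed.

(** Only the reduction [rho] onto a polynomial ring over a field, with kernel
    generated by an element of square zero, enters the description of ideals. *)
Section SquareZeroReduction.
Variables (A : comNzRingType) (F : fieldType) (rho : {rmorphism A -> {poly F}}).
Variable p : A.
Hypotheses (rho_surj : forall b, exists a, rho a = b)
  (rho_ker : forall a, rho a = 0 <-> exists e, a = p * e) (p_sqr0 : p * p = 0).

(** The exponents [k] and [n] come from the image of [I] under [rho] and from
    the torsion ideal.  The last clause holds for every [g] making the first
    generator lie in [I], which leaves the choice of [g] to the user. *)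
Lemma ideal_two_generators (h beta : A) (t : nat) (I : set A) :
    irreducible_poly (rho h) -> is_ideal I -> I (h ^+ t + p * beta) ->
  exists k n, [/\ (n <= k <= t)%N, I (p * h ^+ n),
    exists g, I (h ^+ k + p * g) &
    forall g, I (h ^+ k + p * g) -> forall x, I x ->
      exists u v, x = u * (h ^+ k + p * g) + v * (p * h ^+ n)].
Proof.
move=> h_irr I_ideal If; have [I0 ID IM] := I_ideal.
have rho_p : rho p = 0 by apply/rho_ker; exists 1; rewrite mulr1.
have rho_hp j g : rho (h ^+ j + p * g) = rho h ^+ j.
  by rewrite rmorphD rmorphM rho_p mul0r addr0 rmorphXn.
have [k le_kt Dk] : exists2 k, (k <= t)%N &
    forall b, (rho @` I) b <-> rho h ^+ k %| b.
  apply: ideal_irreducible_power => //; first exact: ideal_image.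
  by exists (h ^+ t + p * beta).
have [n _ Tn] : exists2 n, (n <= t)%N &
    forall b, (rho @` [set g | I (p * g)]) b <-> rho h ^+ n %| b.
  apply: ideal_irreducible_power => //.
    apply: ideal_image => //; split=> [|x y|a x] /=; first by rewrite mulr0.
      by rewrite mulrDr; apply: ID.
    by rewrite mulrCA; apply: IM.
  exists (h ^+ t + p * beta); last exact: rho_hp.
  exact: IM.
(* Membership of [p * g] in [I] depends on [rho g] alone, as [p * p = 0]. *)
have Ip g : rho h ^+ n %| rho g <-> I (p * g).
  split=> [/Tn[g' /= Ig' eq_g]|Ig]; last by apply/Tn; exists g.
  have /rho_ker[e /eqP] : rho (g - g') = 0 by rewrite rmorphB eq_g subrr.
  by rewrite subr_eq => /eqP ->; rewrite mulrDr mulrA p_sqr0 mul0r add0r.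
have [a Ia rho_a] : (rho @` I) (rho h ^+ k) by apply/Dk.
have le_nk : (n <= k)%N.
  have : rho h ^+ n %| rho h ^+ k by rewrite -rho_a Ip; apply: IM.
  by rewrite dvdp_Pexp2l //; case: h_irr.
exists k, n; split=> [||| g Ig x Ix]; first by rewrite le_nk.
- by rewrite -Ip rmorphXn dvdpp.
- have /rho_ker[e a_def] : rho (a - h ^+ k) = 0.
    by rewrite rmorphB rmorphXn rho_a subrr.
  by exists e; rewrite -a_def addrC subrK.
have /dvdpP[c rho_x] : rho h ^+ k %| rho x by apply/Dk; exists x.
have [u rho_u] := rho_surj c; exists u.
have /rho_ker[y y_def] : rho (x - u * (h ^+ k + p * g)) = 0.
  by rewrite rmorphB rmorphM rho_hp rho_u rho_x subrr.
have /Ip/dvdpP[d rho_y] : I (p * y).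
  by rewrite -y_def; apply: ideal_sub => //; apply: IM.
have [v rho_v] := rho_surj d; exists v.
have /rho_ker[e y_eq] : rho (y - v * h ^+ n) = 0.
  by rewrite rmorphB rmorphM rmorphXn rho_v rho_y subrr.
apply/eqP; rewrite addrC -subr_eq y_def -subr_eq0.
by rewrite mulrCA -mulrBr y_eq mulrA p_sqr0 mul0r.
Qed.

End SquareZeroReduction.

(** * Teichmuller representatives and expansions *)

(** The lift has no larger size than [b]: this is what keeps the digits of
    [adic_expansion] of degree smaller than that of [h]. *)
Lemma map_poly_residue_lift (A B : nzRingType) (pi : {rmorphism A -> B})
    (T : {pred A}) :
    0 \in T -> (forall y, exists2 a, a \in T & pi a = y) ->
  forall b : {poly B}, exists a : {poly A},
    [/\ a \is a polyOver T, (size a <= size b)%N & map_poly pi a = b].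
Proof.
move=> T0 T_surj b.
have /choice[s s_def] (y : B) : exists a, a \in T /\ pi a = y.
  by have [a] := T_surj y; exists a.
exists (\poly_(i < size b) s b`_i); split; last 1 first.
- apply/polyP=> i; rewrite coef_map coef_poly; case: ltnP => [_|].
    by case: (s_def b`_i).
  by move=> /(nth_default 0) ->; rewrite /= rmorph0.
- apply/(all_nthP 0) => i _; rewrite coef_poly.
  by case: ifP => // _; case: (s_def b`_i).
exact: size_poly.
Qed.

Section GaloisRing.
Variables (p m : nat) (R : finComNzRingType) (K : finFieldType).
Variable pi : {rmorphism R -> K}.
Hypothesis R_galois : is_galois_ring p m pi.

Lemma galois_ring_kerP (x : R) : pi x = 0 <-> exists e, x = p%:R * e.
Proof.
rewrite (galois_ring_residue_ker R_galois) ideal_gen1P.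
by split=> -[e ->]; exists e; rewrite mulrC.
Qed.

Lemma galois_ring_sqr0 : p%:R * p%:R = 0 :> R.
Proof. by rewrite -natrM; apply/(galois_ring_char R_galois); rewrite mulnn. Qed.

Lemma galois_ring_residue_pchar : p%:R = 0 :> K.
Proof.
by rewrite -(rmorph_nat pi); apply/galois_ring_kerP; exists 1; rewrite mulr1.
Qed.

(** In [x ^+ p - y ^+ p = (x - y) * \sum_i x ^+ (p.-1 - i) * y ^+ i] both
    factors reduce to [0], the second one to [p] times a power of the common
    reduction, so both are multiples of [p] and their product vanishes. *)
Lemma galois_ring_eq_expn (x y : R) : pi x = pi y -> x ^+ p = y ^+ p.
Proof.
move=> eq_xy; apply/eqP; rewrite -subr_eq0 subrXX.
have /galois_ring_kerP[e ->] : pi (x - y) = 0 by rewrite rmorphB eq_xy subrr.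
have /galois_ring_kerP[e' ->] : pi (\sum_(i < p) x ^+ (p.-1 - i) * y ^+ i) = 0.
  rewrite rmorph_sum (eq_bigr (fun=> pi y ^+ p.-1)) => [|i _].
    by rewrite sumr_const card_ord -mulr_natl galois_ring_residue_pchar mul0r.
  rewrite rmorphM !rmorphXn eq_xy -exprD subnK //.
  by rewrite -ltnS prednK ?(leq_ltn_trans _ (ltn_ord i)).
by rewrite mulrACA galois_ring_sqr0 mul0r.
Qed.

(** The powers of [zeta] have distinct reductions: [p]-th powers only depend on
    reductions, and [p] is prime to the order of [zeta].  By counting, these
    reductions exhaust the nonzero elements of [K]. *)
Lemma teichmuller_residue_surj (zeta : R) :
    prime p -> (0 < m)%N -> (p ^ m - 1).-primitive_root zeta ->
  forall y : K, exists2 a, a \in teichmuller p m zeta & pi a = y.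
Proof.
move=> p_prime m_gt0 zeta_prim y.
have [->|y_neq0] := eqVneq y 0.
  by exists 0; rewrite ?rmorph0 // inE eqxx.
pose N := (p ^ m - 1)%N.
have N_gt0 : (0 < N)%N := prim_order_gt0 zeta_prim.
have p_coprime : coprime p N.
  by rewrite -(coprime_pexpl _ _ m_gt0) /N subn1 coprimenP // expn_gt0 prime_gt0.
have pi_inj : injective (fun i : 'I_N => pi (zeta ^+ i)).
  move=> i j /galois_ring_eq_expn; rewrite -!exprM => /eqP.
  rewrite (eq_prim_root_expr zeta_prim) -/N => eq_ij; apply: val_inj => /=.
  rewrite -(modn_small (ltn_ord i)) -(modn_small (ltn_ord j)); apply/eqP.
  have [le_ij|/ltnW le_ji] := leqP i j.
    rewrite eq_sym eqn_mod_dvd // -(Gauss_dvdl _ (p := p)) 1?coprime_sym //.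
    by rewrite mulnBl -eqn_mod_dvd ?leq_mul // eq_sym.
  rewrite eqn_mod_dvd // -(Gauss_dvdl _ (p := p)) 1?coprime_sym //.
  by rewrite mulnBl -eqn_mod_dvd ?leq_mul.
pose E := [set pi (zeta ^+ i) | i : 'I_N]%SET.
have E_card : #|E| = N by rewrite card_imset // card_ord.
have E_units : E = [set~ 0]%SET.
  apply/eqP; rewrite eqEcard E_card cardsC1 (galois_ring_residue_card R_galois) /N.
  rewrite subn1 leqnn andbT; apply/fintype.subsetP=> _ /imsetP[i _ ->]; rewrite !inE.
  rewrite rmorphXn expf_neq0 //; apply: contra_eq_neq (rmorph1 pi) => pi_zeta.
  rewrite -(prim_expr_order zeta_prim) rmorphXn pi_zeta expr0n gtn_eqF //.
  by rewrite eq_sym oner_neq0.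
have /imsetP[i _ ->] : y \in E by rewrite E_units !inE.
exists (zeta ^+ i) => //; rewrite inE; apply/orP; right.
by apply/existsP; exists i.
Qed.

Lemma galois_ring_poly_kerP (g : {poly R}) :
  map_poly pi g = 0 <-> exists e, g = p%:R * e.
Proof.
split=> [pi_g|[e ->]]; last first.
  apply/polyP=> i; rewrite coef_map mulr_natl coefMn coef0 raddfMn.
  by rewrite -mulr_natl galois_ring_residue_pchar mul0r.
have /choice[e e_def] (i : nat) : exists e, g`_i = p%:R * e.
  by apply/galois_ring_kerP; rewrite -coef_map pi_g coef0.
exists (\poly_(i < size g) e i); apply/polyP=> i.
rewrite mulr_natl coefMn -mulr_natl coef_poly; case: ltnP => [_|] //.
by move=> /(nth_default 0) ->; rewrite mulr0.
Qed.

(** Iterated division by [h], replacing each remainder by the polynomial with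
    coefficients in [T] that has the same reduction; the errors are gathered in
    the term in [p].  The digits of index at least [n] are set to zero so that
    the sum may be extended past [n]. *)
Lemma adic_expansion (T : {pred R}) (h : {poly R}) :
    0 \in T -> (forall y, exists2 a, a \in T & pi a = y) -> h \is monic ->
  forall (n : nat) (g : {poly R}), exists (eta : nat -> {poly R}) c e,
    [/\ forall j, eta j \is a polyOver T /\ (size (eta j) < size h)%N,
        forall j, (n <= j)%N -> eta j = 0 &
        g = \sum_(j < n) eta j * h ^+ j + h ^+ n * c + p%:R * e].
Proof.
move=> T0 T_surj h_monic; have h_neq0 := monic_neq0 h_monic.
elim=> [|n IHn] g.
  exists (fun=> 0), g, 0; split=> // [j|]; last by rewrite big_ord0; ring.
  rewrite size_poly0 size_poly_gt0; split=> //.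
  by apply/(all_nthP 0) => i; rewrite size_poly0.
have g_def := Pdiv.RingMonic.rdivp_eq h_monic g.
set g' := (X in X * h) in g_def; set r := (X in _ + X) in g_def.
have [a [aT size_a pi_a]] := map_poly_residue_lift T0 T_surj (map_poly pi r).
have lt_a : (size a < size h)%N.
  apply: leq_ltn_trans size_a _; apply: leq_ltn_trans (size_poly _ _) _.
  by rewrite Pdiv.CommonRing.ltn_rmodp.
have /galois_ring_poly_kerP[e r_def] : map_poly pi (r - a) = 0.
  by rewrite rmorphB /= pi_a subrr.
have [eta [c [e' [eta_digit eta0 g'_def]]]] := IHn g'.
exists (fun j => if j is j'.+1 then eta j' else a), c, (e' * h + e); split.
- by case.
- by case=> // j; apply: eta0.
rewrite g_def -[r](subrK a) r_def g'_def big_ord_recl /= expr0 exprS.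
under [in RHS]eq_bigr do rewrite exprS mulrCA mulrC.
by rewrite -mulr_suml; ring.
Qed.
End GaloisRing.

(** The exponent [l] is the least index of a nonzero digit.  A [delta] has
    [k - l] digits, whereas the expansion stops at [n <= k]; the missing digits
    are zero. *)
Lemma delta_factor (R : finComNzRingType) (T : {pred R}) (h : {poly R})
    (eta : nat -> {poly R}) (n k : nat) :
    (n <= k)%N ->
    (forall j, eta j \is a polyOver T /\ (size (eta j) < size h)%N) ->
    (forall j, (n <= j)%N -> eta j = 0) ->
  \sum_(j < n) eta j * h ^+ j = 0 \/
  exists l delta, [/\ (l < n)%N, is_delta T h k l delta &
    \sum_(j < n) eta j * h ^+ j = h ^+ l * delta].
Proof.
move=> le_nk eta_digit eta0.
have [eta_neq0|eta_all0] := pselect (exists l, eta l != 0); last first.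
  left; apply: big1 => j _; have [->|eta_neq0] := eqVneq (eta j) 0.
    by rewrite mul0r.
  by case: eta_all0; exists j.
right; case: (ex_minnP eta_neq0) => l eta_l l_min.
have lt_ln : (l < n)%N by rewrite ltnNge; apply: contra eta_l => /eta0->.
exists l, (\sum_(j < k - l) eta (l + j)%N * h ^+ j); split=> //.
  by exists (fun j => eta (l + j)%N); split=> //; rewrite addn0; apply/eqP.
have sum_ext : \sum_(j < n) eta j * h ^+ j = \sum_(0 <= j < k) eta j * h ^+ j.
  rewrite -(big_mkord xpredT (fun j => eta j * h ^+ j)) (big_cat_nat (leq0n n) le_nk) //=.
  rewrite [X in _ + X]big_nat_cond [X in _ + X]big1 ?addr0 // => j.
  by rewrite andbT => /andP[/eta0-> _]; rewrite mul0r.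
have le_lk : (l <= k)%N := leq_trans (ltnW lt_ln) le_nk.
rewrite sum_ext (big_cat_nat (leq0n l) le_lk) //= [X in X + _]big_nat_cond.
rewrite [X in X + _]big1 ?add0r => [|j]; last first.
  rewrite andbT => /andP[_ lt_jl]; have [->|/l_min] := eqVneq (eta j) 0.
    by rewrite mul0r.
  by rewrite leqNgt lt_jl.
rewrite -{1}[l]add0n big_addn big_mkord mulr_sumr; apply: eq_bigr => j _.
by rewrite addnC exprD mulrCA.
Qed.

(** * The quotient by f *)

Lemma in_qpoly_surj (A : comNzRingType) (f : {poly A}) (y : {poly %/ f}) :
  exists g, in_qpoly f g = y.
Proof.
by exists (y : {poly A}); apply: val_inj; apply: in_qpoly_small; apply: size_mk_monic.
Qed.

(** [{poly %/ f}] is the quotient by [f] only if [f] is monic of size greater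
    than [1]; a monic constant would be the unit [1]. *)
Lemma in_qpoly_self (A : comNzRingType) (f : {poly A}) :
  f \is monic -> ~ is_unit f -> in_qpoly f f = 0.
Proof.
move=> f_monic f_nonunit; apply: val_inj => /=; suff f_gt1 : (1 < size f)%N.
  by rewrite /mk_monic f_gt1 f_monic Pdiv.RingMonic.rmodpp.
rewrite ltnNge; apply/negP=> /size1_polyC f_def; case: f_nonunit; exists 1.
have := f_monic; rewrite {1}f_def monicE lead_coefC => /eqP f0.
by rewrite mul1r f_def f0.
Qed.

Theorem lemma4p1 (p m : nat) (p_prime : prime p) (m_gt0 : (0 < m)%N)
  (R : finComNzRingType) (K : finFieldType) (pi : {rmorphism R -> K})
  (R_galois : is_galois_ring p m pi)
  (zeta : R) (zeta_prim : (p ^ m - 1).-primitive_root zeta)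
  (f h beta : {poly R}) (t : nat)
  (f_monic : f \is monic)
  (f_regular : GRing.lreg f)
  (f_primary : primary_ideal (ideal_gen [set f]))
  (f_nonunit : ~ is_unit f)
  (t_gt0 : (0 < t)%N)
  (h_monic : h \is monic)
  (h_basic : basic_irreducible pi h)
  (beta_deg : beta = 0 \/ ((size beta).-1 < t * (size h).-1)%N)
  (f_def : f = h ^+ t + p%:R * beta)
  (C : set {poly %/ f}) (C_ideal : is_ideal C) :
  let T := teichmuller p m zeta in
  let q := in_qpoly f in
  C = ideal_gen [set 0] \/
  C = ideal_gen [set 1] \/
  (exists n : nat,
     (n < t)%N /\
     C = ideal_gen [set q (p%:R * h ^+ n)]) \/
  (exists k : nat,
     (k < t)%N /\
     C = ideal_gen [set q (h ^+ k)]) \/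
  (exists (k l : nat) (delta : {poly R}),
     [/\ (l < k)%N, (k < t)%N, is_delta T h k l delta &
         C = ideal_gen [set q (h ^+ k + p%:R * h ^+ l * delta)]]) \/
  (exists k n : nat,
     [/\ (n < k)%N, (k < t)%N &
         C = ideal_gen [set q (h ^+ k); q (p%:R * h ^+ n)]]) \/
  (exists (k l n : nat) (delta : {poly R}),
     [/\ (l < n)%N, (n < k)%N, (k < t)%N, is_delta T h k l delta &
         C = ideal_gen [set q (h ^+ k + p%:R * h ^+ l * delta);
                            q (p%:R * h ^+ n)]]).
Proof.
move=> T q.
have q_f : q f = 0 := in_qpoly_self f_monic f_nonunit.
have p_sqr0 : p%:R * p%:R = 0 :> {poly R}.
  by rewrite -!(rmorph_nat polyC) -polyCM (galois_ring_sqr0 R_galois).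
have T0 : 0 \in T by rewrite inE eqxx.
have T_surj := teichmuller_residue_surj R_galois p_prime m_gt0 zeta_prim.
have pi_surj b : exists g, map_poly pi g = b.
  by have [g []] := map_poly_residue_lift T0 T_surj b; exists g.
have qI_ideal : is_ideal (q @^-1` C) := ideal_preimage q C_ideal.
have qI_f : C (q (h ^+ t + p%:R * beta)) by rewrite -f_def q_f; case: C_ideal.
have [k [n [/andP[le_nk le_kt] Cph [g0 Cg0] gen]]] :=
  ideal_two_generators pi_surj (galois_ring_poly_kerP R_galois) p_sqr0
    (proj2 h_basic) qI_ideal qI_f.
rewrite /= in Cph Cg0 gen.
have gen_q g : C (q (h ^+ k + p%:R * g)) -> forall y, C y ->
    exists u v, y = u * q (h ^+ k + p%:R * g) + v * q (p%:R * h ^+ n).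
  move=> Cg y; have [x <-] := in_qpoly_surj y => /(gen g Cg)[u [v ->]].
  by exists (q u), (q v); rewrite /q [LHS]rmorphD !rmorphM.
have q_ph : q (p%:R * h ^+ t) = 0.
  have -> : p%:R * h ^+ t = p%:R * f.
    by rewrite f_def mulrDr mulrA p_sqr0 mul0r addr0.
  by transitivity (q p%:R * q f); [exact: rmorphM | rewrite q_f mulr0].
(* With [g = beta] the first generator is [f], whose class is zero. *)
have [k_t|] := eqVneq k t.
  have gen_p y : C y -> exists u, y = u * q (p%:R * h ^+ n).
    move=> Cy; have := gen_q beta; rewrite k_t -f_def q_f => /(_ _ y Cy).
    by case=> [|u [v ->]]; [case: C_ideal | exists v; rewrite mulr0 add0r].
  move: le_nk; rewrite k_t leq_eqVlt => /predU1P[n_t | lt_nt]; last first.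
    by right; right; left; exists n; split=> //; apply: ideal_gen1_eq.
  left; rewrite n_t q_ph in gen_p.
  by apply: ideal_gen1_eq => //; case: C_ideal.
move=> neq_kt; have lt_kt : (k < t)%N by rewrite ltn_neqAle neq_kt.
have [k0|k_gt0] := posnP k.
  right; left; apply: ideal_gen1_eq => // [|y _]; last by exists y; rewrite mulr1.
  (* [1 - p * g0] is the inverse of the generator [1 + p * g0]. *)
  have -> : 1 = q ((1 - p%:R * g0) * (h ^+ k + p%:R * g0)).
    rewrite k0 expr0 -(rmorph1 q); congr q.
    by transitivity (1 - (p%:R * p%:R) * (g0 * g0)); [rewrite p_sqr0 | ]; ring.
  by rewrite /q rmorphM; case: C_ideal => _ _; apply.
have [eta [c [e [eta_digit eta0 g0_def]]]] :=
  adic_expansion R_galois T0 T_surj h_monic n g0.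
set s := \sum_(j < n) _ in g0_def.
(* Passing from [g0] to [s] changes the first generator by a multiple of the
   second. *)
have Cs : C (q (h ^+ k + p%:R * s)).
  have -> : h ^+ k + p%:R * s = h ^+ k + p%:R * g0 - c * (p%:R * h ^+ n).
    rewrite g0_def.
    transitivity (h ^+ k + p%:R * s + (p%:R * p%:R) * e); last by ring.
    by rewrite p_sqr0; ring.
  rewrite /q rmorphB; apply: ideal_sub => //; rewrite rmorphM.
  by case: C_ideal => _ _; apply.
have {}gen_q := gen_q s Cs.
(* For [n = k] the second generator is [p] times the first. *)
have gen_nk : n = k -> forall y, C y -> exists u, y = u * q (h ^+ k + p%:R * s).
  move=> n_k y Cy; have [u [v ->]] := gen_q y Cy; exists (u + v * q p%:R).
  rewrite mulrDl -mulrA -[q p%:R * _]rmorphM n_k; congr (_ + _ * q _).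
  by rewrite mulrDr [p%:R * (p%:R * _)]mulrA p_sqr0 mul0r addr0.
have [s0|[l [delta [lt_ln delta_def s_def]]]] := delta_factor le_nk eta_digit eta0.
  rewrite -/s in s0; rewrite s0 mulr0 addr0 in Cs gen_q gen_nk.
  move: le_nk; rewrite leq_eqVlt => /predU1P[n_k | lt_nk].
    do 3!right; left; exists k; split=> //.
    by apply: ideal_gen1_eq => //; apply: gen_nk.
  by do 5!right; left; exists k, n; split=> //; apply: ideal_gen2_eq.
rewrite -/s in s_def; rewrite s_def mulrA in Cs gen_q gen_nk.
move: le_nk; rewrite leq_eqVlt => /predU1P[n_k | lt_nk].
  do 4!right; left; exists k, l, delta; split=> //; first by rewrite -n_k.
  by apply: ideal_gen1_eq => //; apply: gen_nk.
by do 6!right; exists k, l, n, delta; split=> //; apply: ideal_gen2_eq.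
Qed.
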